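(* Let $T>0$ and let $\omega$ be a $C^1$ function on $[0,T]$ such that $\omega_0=0$ and with negative derivative (i.e. $\omega'_t<0$ for $t\in[0,T]$). Let $b\colon\mathbb R\to\mathbb R$ and consider the problem $$x'_t=b(x_t)+\omega'_t\ \text{ for almost every } t\in[0,T],\qquad x_0=0. \tag{$*$}$$ Assume that: (i) $b$ is measurable and $\lim_{x\to0}b(x)=b(0)=0$. (ii) For some $\eta\in(0,\infty]$ there exists a (strictly) increasing continuous function $g\colon[0,\eta)\to\mathbb R$, of class $C^1$ on $(0,\eta)$, with $g'$ non-increasing, and such that $x\mapsto g'(-x)b(x)$ is non-increasing on $(-\eta,0)$. (iii) There exists either a maximal or a minimal solution to $( * )$. Then there is a unique local solution to $( * )$. Global uniqueness on $[0,T]$ is true if $\eta=\infty$.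
   Context: Solutions of $( * )$ are absolutely continuous functions $x$ with $x_0=0$ satisfying the differential equation almost everywhere on their interval of definition ($[0,T]$, or $[0,\tau]$ for some $\tau\in(0,T]$ in the case of local solutions). A maximal (respectively minimal) solution is a solution that is pointwise $\ge$ (respectively $\le$) every other solution on the common interval of existence. ''There is a unique local solution'' means that for some $\tau\in(0,T]$ there is one and only one solution on $[0,\tau]$. ''Global uniqueness on $[0,T]$'' means that any two solutions on $[0,T]$ coincide on the whole of $[0,T]$. *)

(* Defs.v *)
From HB Require Import structures.
From mathcomp Require Import all_boot all_order all_algebra.
From mathcomp Require Import all_classical all_reals all_analysis.
Import Order.TTheory GRing.Theory Num.Theory numFieldNormedType.Exports.

Set Implicit Arguments.
Unset Strict Implicit.
Unset Printing Implicit Defensive.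

Local Open Scope classical_set_scope.
Local Open Scope ring_scope.

(* A function on a subset A of the line is represented by a total function
   R -> R of which only the values on A matter. *)

Definition quotient_within (R : realType) (f : R -> R) (t : R) : R -> R :=
  fun s => (f s - f t) / (s - t).

(* The limit is taken along s in A with s <> t, so that on a segment it is the
   one-sided derivative at an end point and the ordinary one inside. *)
Definition derive_within (R : realType) (A : set R) (f : R -> R) (t : R) : R :=
  lim (quotient_within f t @ within A t^').

Definition C1_within (R : realType) (A : set R) (f : R -> R) : Prop :=
  (forall t : R, A t -> cvg (quotient_within f t @ within A t^')) /\
  {within A, continuous (derive_within A f)}.

(* Degenerate intervals (u i = v i) are allowed and contribute 0 to both
   sums. *)
Definition absolutely_continuous (R : realType) (a b : R) (f : R -> R) : Prop :=
  forall e : R, 0 < e -> exists2 d : R, 0 < d &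
    forall (n : nat) (u v : 'I_n -> R),
      (forall i, a <= u i /\ u i <= v i /\ v i <= b) ->
      trivIset setT (fun i => [set` `]u i, v i[]) ->
      \sum_(i < n) (v i - u i) < d ->
      \sum_(i < n) `|f (v i) - f (u i)| < e.

(* Almost every t of [0, tau] is interior, so the two-sided derivative of x
   used here does not depend on the values of x outside [0, tau]. *)
Definition is_solution (R : realType) (b omega : R -> R) (T tau : R)
    (x : R -> R) : Prop :=
  [/\ absolutely_continuous 0 tau x,
      x 0 = 0 &
      {ae (@lebesgue_measure R), forall t : R, 0 <= t <= tau ->
        is_derive t 1 x (b (x t) + derive_within `[0, T] omega t)}].

Definition is_maximal_solution (R : realType) (b omega : R -> R) (T tau : R)
    (x : R -> R) : Prop :=
  is_solution b omega T tau x /\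
  forall (sigma : R) (y : R -> R), 0 < sigma <= T ->
    is_solution b omega T sigma y ->
    forall t : R, 0 <= t -> t <= tau -> t <= sigma -> y t <= x t.

Definition is_minimal_solution (R : realType) (b omega : R -> R) (T tau : R)
    (x : R -> R) : Prop :=
  is_solution b omega T tau x /\
  forall (sigma : R) (y : R -> R), 0 < sigma <= T ->
    is_solution b omega T sigma y ->
    forall t : R, 0 <= t -> t <= tau -> t <= sigma -> x t <= y t.

(* Main.v *)
Require Import Defs.
From HB Require Import structures.
From mathcomp Require Import all_boot all_order all_algebra.
From mathcomp Require Import all_classical all_reals all_analysis.
From mathcomp Require Import ring lra.
Import Order.TTheory GRing.Theory Num.Theory numFieldNormedType.Exports.

(** Why the theorem is true.

    Because omega' < 0 while b(x) -> 0 as x -> 0, the drift is negative near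
    the level 0, so that every solution is negative at all positive times
    ([solution_negative]).  This is the region where the hypotheses on g apply.

    Suppose that two solutions x and y, say with y < x, separate after a time s
    at which they agree.  As long as -eta < y < x < 0, the gap
    g(-y) - g(-x) is positive since g is increasing, and it is non-increasing
    by the monotonicity of g' and of z |-> g'(-z) b(z)
    ([solution_gap_noninc]).  Since it tends to 0 at time s, this is absurd
    ([solutions_not_separate]).  The last time at which two distinct solutions
    meet, given by [last_nonpositive], thus leads to a contradiction as soon as
    one of them stays above -eta ([solution_unique]).  For eta = +oo there is
    no restriction, whence global uniqueness.  For finite eta a solution
    starting from 0 stays above -eta for a short time; the extremal solution
    provides the existence of one.

    The passage from a sign of the derivative almost everywhere to monotonicity
    is [absolutely_continuous_le], proved by a covering argument. *)

Set Implicit Arguments.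
Unset Strict Implicit.
Unset Printing Implicit Defensive.

Local Open Scope classical_set_scope.
Local Open Scope ring_scope.

(** * Monotonicity from almost everywhere information *)

Lemma exists_right_near (R : realType) (s b d : R) :
  s < b -> 0 < d -> exists v, [/\ s < v, v <= b & v < s + d].
Proof.
move=> sb d0; exists (Num.min b (s + d / 2)).
rewrite lt_min sb ge_min lexx gt_min; split=> //; first lra.
by apply/orP; right; lra.
Qed.

(** Cousin's compactness argument as an induction principle: the hypothesis
    only compares points on the two sides of t, which is what differentiability
    at the single point t gives.  The supremum of the points reached from a
    is itself reached, and passed unless it is b. *)
Lemma straddle_induction (R : realType) (a b : R) (P : R -> Prop) :
  a <= b -> P a ->
  (forall t, a <= t <= b -> exists2 d, 0 < d & forall u v,
     a <= u -> t - d < u -> u <= t -> t <= v -> v < t + d -> v <= b ->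
     P u -> P v) ->
  P b.
Proof.
move=> ab Pa step.
pose S := [set t | a <= t <= b /\ P t].
have Sa : S a by split=> //; rewrite lexx ab.
have Sb : ubound S b by move=> t [/andP[]].
have supS : has_sup S by split; [exists a | exists b].
have zab : a <= sup S <= b.
  by rewrite (ub_le_sup supS.2 Sa)/=; apply: ge_sup => //; exists a.
have [d d0 H] := step _ zab.
have [u [/andP[au ub] Pu] du] := sup_adherent d0 supS.
have uz : u <= sup S by apply: (ub_le_sup supS.2); split=> //; rewrite au.
case/andP: zab => az zb.
have [zltb|] := ltP (sup S) b; last first.
  by move=> bz; apply: (H u) => //; lra.
have [v [zv vb vd]] := exists_right_near zltb d0.
have Sv : S v.
  split; first by apply/andP; split; lra.
  by apply: (H u) => //; lra.
have := ub_le_sup supS.2 Sv; lra.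
Qed.

Lemma is_derive_slope (R : realType) (f : R -> R) (t d e : R) :
  is_derive t 1 f d -> 0 < e ->
  exists2 r, 0 < r & forall s, `|s - t| < r ->
    `|f s - f t - d * (s - t)| <= e * `|s - t|.
Proof.
move=> [fd <-] e0.
have /cvgrPdist_le /(_ _ e0) : h^-1 *: ((f \o shift t) (h *: 1) - f t)
    @[h --> 0^'] --> 'D_1 f t by exact: fd.
rewrite near_withinE => /nbhs_ballP[r /= r0 H].
exists r => // s st; have [->|st0] := eqVneq s t.
  by rewrite !subrr mulr0 subrr normr0 mulr0.
have h0 : s - t != 0 by rewrite subr_eq0.
have := H (s - t); rewrite /ball /= sub0r normrN => /(_ st h0).
rewrite /shift /= [_ *: 1]mulr1 subrK => K.
have -> : f s - f t - 'D_1 f t * (s - t) =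
    - (('D_1 f t - (s - t)^-1 * (f s - f t)) * (s - t)) by field.
by rewrite normrN normrM ler_wpM2r.
Qed.

(** The form of absolute continuity used below.  Lists can be extended at the
    right end of an interval during an induction, and the total length of
    disjoint intervals is controlled by an open set that contains them. *)
Lemma absolutely_continuous_seq (R : realType) (a b : R) (F : R -> R) :
  absolutely_continuous a b F -> forall e, 0 < e ->
  exists2 d, 0 < d & forall U : set R, measurable U ->
    (lebesgue_measure U < d%:E)%E ->
    forall l : seq (R * R),
      all (fun p => [&& a <= p.1, p.1 <= p.2 & p.2 <= b]) l ->
      pairwise (fun p q => q.2 <= p.1) l ->
      (forall p, p \in l -> [set` `]p.1, p.2[] `<=` U) ->
      \sum_(p <- l) `|F p.2 - F p.1| < e.
Proof.
move=> acF e e0; have [d d0 H] := acF e e0; exists d => // U mU Ud l lab ldisj lU.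
rewrite (big_nth (0, 0)) big_mkord.
set u := fun i : 'I_(size l) => (nth (0, 0) l i).1.
set v := fun i : 'I_(size l) => (nth (0, 0) l i).2.
have uv i : a <= u i /\ u i <= v i /\ v i <= b.
  by have /and3P[] := all_nthP (0, 0) lab i (ltn_ord i).
have triv : trivIset setT (fun i => [set` `]u i, v i[]).
  have disj (i j : 'I_(size l)) : (i < j)%N -> v j <= u i.
    by move=> ij; apply: (pairwiseP (0, 0) ldisj) => //; rewrite inE.
  move=> i j _ _ [z [/=]]; rewrite !in_itv /= => /andP[uz zv] /andP[uz' zv'].
  apply: val_inj => /=; have [ij|ji|//] := ltngtP i j.
    by have := lt_trans (lt_le_trans zv' (disj _ _ ij)) uz; rewrite ltxx.
  by have := lt_trans (lt_le_trans zv (disj _ _ ji)) uz'; rewrite ltxx.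
apply: (H _ u v) => //.
rewrite -lte_fin; apply: le_lt_trans Ud.
have mI i : measurable [set` `]u i, v i[] by exact: measurable_itv.
rewrite -sumEFin.
have -> : (\sum_(i < size l) (v i - u i)%:E =
    lebesgue_measure (\big[setU/set0]_(i < size l) ([set` `]u i, v i[] : set R)))%E.
  rewrite measure_semi_additive_ord //; last exact: bigsetU_measurable.
  apply: eq_bigr => i _.
  rewrite [RHS](lebesgue_measure_itv `]u i, v i[) /= lte_fin.
  case: ltP => // vu; have [_ [uvi _]] := uv i.
  by rewrite EFinB (_ : v i = u i) ?subee //; apply/le_anti; rewrite uvi vu.
apply: le_measure; rewrite ?inE //; first exact: bigsetU_measurable.
apply: (big_ind (fun A => A `<=` U)) => [|A B AU BU|i _].
- exact: sub0set.
- by rewrite subUset.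
- by apply: lU; exact: mem_nth.
Qed.

(** The exceptional null set lies in an open set U of
    small measure.  Moving to the right, a point where F' <= 0 lets F increase
    at a rate at most e', while around an exceptional point the increase is
    charged to an interval contained in U.  The charged intervals are disjoint
    and of small total length, so by absolute continuity they contribute
    little. *)
Lemma absolutely_continuous_le (R : realType) (a b : R) (F : R -> R) :
  a <= b -> absolutely_continuous a b F ->
  {ae (@lebesgue_measure R), forall t, a <= t <= b ->
     exists2 d, is_derive t 1 F d & d <= 0} ->
  F b <= F a.
Proof.
move=> ab acF [N [mN N0 sub]].
apply/ler_addgt0Pl => e e0.
pose e' := e / 2 / (b - a + 1).
have ba1 : 0 < b - a + 1 by lra.
have e'0 : 0 < e' by rewrite !divr_gt0.
have e2 : 0 < e / 2 by rewrite divr_gt0.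
have [d d0 smallvar] := absolutely_continuous_seq acF e2.
have N0d : (lebesgue_measure N < +oo)%E by rewrite N0.
have [U [oU NU UNd]] := lebesgue_regularity_outer mN N0d d0.
have mU : measurable U by exact: measurable_realfun.open_measurable.
have Ud : (lebesgue_measure U < d%:E)%E.
  rewrite -(setDUK NU); apply: le_lt_trans UNd.
  apply: le_trans (measureU2 _ _ _) _ => //; first exact: measurableD.
  have N0' : (lebesgue_measure N <= 0)%E by rewrite N0.
  rewrite -[leRHS]add0e leeD //; exact: N0'.
(* The intervals of l are those charged so far, between a and t. *)
pose P t := exists l : seq (R * R),
  [/\ all (fun p => [&& a <= p.1, p.1 <= p.2 & p.2 <= t]) l,
      pairwise (fun p q => q.2 <= p.1) l,
      (forall p, p \in l -> [set` `]p.1, p.2[] `<=` U) &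
      F t - F a <= e' * (t - a) + \sum_(p <- l) `|F p.2 - F p.1|].
have [l [lb ldisj lU Fl]] : P b; last first.
  have := smallvar _ mU Ud l lb ldisj lU => S.
  have E : e' * (b - a + 1) = e / 2 by rewrite /e' divfK ?gt_eqF.
  by clear -Fl S E e'0; lra.
apply: (@straddle_induction R a b) => //.
  by exists [::]; split=> //; rewrite big_nil !subrr mulr0 addr0.
move=> t tab.
have grow u v l : u <= v ->
    all (fun p => [&& a <= p.1, p.1 <= p.2 & p.2 <= u]) l ->
    all (fun p => [&& a <= p.1, p.1 <= p.2 & p.2 <= v]) l.
  move=> uv; apply: sub_all => p /and3P[-> -> pu] /=.
  exact: le_trans pu uv.
have [Nt|Nt] := pselect (N t).
  have Ut := NU _ Nt.
  have /nbhs_ballP[r /= r0 rU] := open_nbhs_nbhs (conj oU Ut).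
  exists r => // u v au tu ut tv vt vb [l [lb ldisj lU Fl]].
  have uv : u <= v := le_trans ut tv.
  exists ((u, v) :: l); split => /=.
  - by rewrite au uv lexx /=; exact: grow lb.
  - rewrite ldisj andbT; apply: sub_all lb => p /and3P[_ _]; exact.
  - move=> p; rewrite inE => /orP[/eqP->|/lU//] z /=.
    rewrite in_itv /= => /andP[uz zv]; apply: rU; rewrite /ball /=.
    by rewrite distrC ltr_distl; apply/andP; split; lra.
  - rewrite big_cons /=.
    have K : 0 <= e' * (v - u) + `|F v - F u| - (F v - F u).
      by rewrite -addrA addr_ge0 ?subr_ge0 ?ler_norm // mulr_ge0 ?subr_ge0 // ltW.
    by clear -Fl K; lra.
have [c Fc ck] : exists2 d, is_derive t 1 F d & d <= 0.
  by apply: contrapT => nc; apply/Nt/sub => /= H; exact/nc/H.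
have [r r0 slope] := is_derive_slope Fc e'0.
exists r => // u v au tu ut tv vt vb [l [lb ldisj lU Fl]].
have uv : u <= v := le_trans ut tv.
exists l; split => //; first exact: grow lb.
have : `|u - t| < r by rewrite ltr_distl; apply/andP; split; lra.
have : `|v - t| < r by rewrite ltr_distl; apply/andP; split; lra.
move=> /slope + /slope; rewrite !ler_norml.
rewrite (ger0_norm (_ : 0 <= v - t)) ?subr_ge0 //.
rewrite (ler0_norm (_ : u - t <= 0)) ?subr_le0 // => /andP[_ H1] /andP[H2 _].
have : 0 <= (0 - c) * (v - u) by rewrite mulr_ge0 ?subr_ge0.
by clear -H1 H2 Fl; lra.
Qed.

Lemma absolutely_continuous_id (R : realType) (a b : R) :
  absolutely_continuous a b (@id R).
Proof.
move=> e e0; exists e => // n u v uv _.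
suff -> : \sum_(i < n) `|v i - u i| = \sum_(i < n) (v i - u i) by [].
by apply: eq_bigr => i _; rewrite ger0_norm // subr_ge0; case: (uv i) => _ [].
Qed.

(** Covers at once linear combinations and, with L a Lipschitz constant, the
    composition with a Lipschitz function. *)
Lemma absolutely_continuous_dominated (R : realType) (a b L : R)
    (F G H : R -> R) :
  absolutely_continuous a b F -> absolutely_continuous a b G ->
  (forall u v, a <= u -> u <= v -> v <= b ->
     `|H v - H u| <= L * (`|F v - F u| + `|G v - G u|)) ->
  absolutely_continuous a b H.
Proof.
move=> acF acG HL e e0.
pose M := `|L| + 1.
have M0 : 0 < M by rewrite ltr_wpDl.
have LM : L <= M by rewrite (le_trans (ler_norm L)) // lerDl.
have e'0 : 0 < e / 2 / M by rewrite !divr_gt0.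
have [d1 d10 H1] := acF _ e'0; have [d2 d20 H2] := acG _ e'0.
exists (Num.min d1 d2); first by rewrite lt_min d10.
move=> n u v uv triv; rewrite lt_min => /andP[l1 l2].
have S1 := H1 n u v uv triv l1; have S2 := H2 n u v uv triv l2.
apply: (@le_lt_trans _ _
  (M * (\sum_(i < n) `|F (v i) - F (u i)| + \sum_(i < n) `|G (v i) - G (u i)|))).
  rewrite -big_split mulr_sumr; apply: ler_sum => i _.
  have [au [le_uv vb]] := uv i.
  by apply: (le_trans (HL _ _ au le_uv vb)); rewrite ler_wpM2r ?addr_ge0.
rewrite mulrC -ltr_pdivlMr //; lra.
Qed.

Lemma absolutely_continuous_sub (R : realType) (a b a' b' : R) (F : R -> R) :
  a <= a' -> b' <= b ->
  absolutely_continuous a b F -> absolutely_continuous a' b' F.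
Proof.
move=> aa bb acF e e0; have [d d0 H] := acF _ e0; exists d => // n u v uv.
apply: H => i; have [au [le_uv vb]] := uv i.
by split; [exact: le_trans au | split=> //; exact: le_trans bb].
Qed.

Lemma absolutely_continuous_modulus (R : realType) (a b : R) (F : R -> R) :
  absolutely_continuous a b F -> forall e, 0 < e -> exists2 d, 0 < d &
    forall s t, a <= s <= b -> a <= t <= b -> `|t - s| < d ->
      `|F t - F s| < e.
Proof.
move=> acF e e0; have [d d0 H] := acF _ e0; exists d => //.
have sym s t : a <= s <= b -> a <= t <= b -> s <= t -> `|t - s| < d ->
    `|F t - F s| < e.
  move=> /andP[as_ _] /andP[_ tb] st; rewrite ger0_norm ?subr_ge0 // => td.
  have := H 1%N (fun=> s) (fun=> t); rewrite !big_ord1; apply=> //.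
  by move=> i j _ _ _; rewrite (ord1 i) (ord1 j).
move=> s t sI tI; have [st|/ltW ts] := leP s t; first exact: sym.
by rewrite distrC (distrC (F t)); exact: sym.
Qed.

Lemma absolutely_continuous_within (R : realType) (a b : R) (F : R -> R) :
  absolutely_continuous a b F -> {within `[a, b], continuous F}.
Proof.
move=> acF; apply/subspace_continuousP => t; rewrite /= in_itv /= => tI.
apply/cvgrPdist_lt => e /(absolutely_continuous_modulus acF)[d d0 H].
rewrite near_withinE; apply/nbhs_ballP; exists d => // s /=.
by rewrite /ball /= in_itv /= => ts sI; exact: H.
Qed.

(** Applied to a difference of two solutions, this gives the last time at
    which they meet before a time at which they differ. *)
Lemma last_nonpositive (R : realType) (a b : R) (f : R -> R) :
  absolutely_continuous a b f -> a <= b -> f a <= 0 -> 0 < f b ->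
  exists s, [/\ a <= s, s < b, f s = 0 & forall t, s < t <= b -> 0 < f t].
Proof.
move=> acf ab fa fb.
pose S := [set t | a <= t <= b /\ f t <= 0].
have Sa : S a by split=> //; rewrite lexx ab.
have Sb : ubound S b by move=> t [/andP[]].
have supS : has_sup S by split; [exists a | exists b].
set s := sup S.
have as_ : a <= s := ub_le_sup supS.2 Sa.
have sb : s <= b by apply: ge_sup => //; exists a.
have pos t : s < t <= b -> 0 < f t.
  move=> /andP[st tb]; rewrite ltNge; apply/negP => ft.
  have : t <= s by apply: (ub_le_sup supS.2); split=> //; apply/andP; split; lra.
  lra.
have fs0 : f s <= 0.
  rewrite leNgt; apply/negP => fs.
  have [d d0 H] := absolutely_continuous_modulus acf fs.
  have [u [uI fu] us] := sup_adherent d0 supS.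
  have us' : u <= s := ub_le_sup supS.2 (conj uI fu).
  have : `|f u - f s| < f s.
    apply: H => //; first by apply/andP.
    by rewrite ltr_distl; apply/andP; rewrite -/s in us; split; lra.
  by rewrite ltr_distl => /andP[]; lra.
have sltb : s < b.
  rewrite lt_neqAle sb andbT; apply/eqP => E; rewrite E in fs0; lra.
exists s; split=> //.
apply/eqP; rewrite eq_le fs0 leNgt; apply/negP => fs.
have [|d d0 H] := @absolutely_continuous_modulus _ _ _ _ acf (- f s); first lra.
have [t [st tb ts]] := exists_right_near sltb d0.
have : `|f t - f s| < - f s.
  apply: H; try (apply/andP; split; lra).
  by rewrite ltr_distl; apply/andP; split; lra.
have := pos t; rewrite st tb => /(_ isT) ft.
by rewrite ltr_distl => /andP[]; lra.
Qed.

(** * Solutions stay negative *)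

Lemma lebesgue_ae2 (R : realType) (P Q S : R -> Prop) :
  (forall t, P t -> Q t -> S t) ->
  {ae (@lebesgue_measure R), forall t, P t} ->
  {ae (@lebesgue_measure R), forall t, Q t} ->
  {ae (@lebesgue_measure R), forall t, S t}.
Proof.
exact: (@filterS2 _ _ (ae_filter_ringOfSetsType (@lebesgue_measure R))).
Qed.

Lemma lebesgue_ae1 (R : realType) (P Q : R -> Prop) :
  (forall t, P t -> Q t) ->
  {ae (@lebesgue_measure R), forall t, P t} ->
  {ae (@lebesgue_measure R), forall t, Q t}.
Proof. by move=> PQ aeP; apply: (lebesgue_ae2 _ aeP aeP) => t /PQ. Qed.

Lemma solution_restrict (R : realType) (b omega : R -> R) (T tau tau' : R)
    (x : R -> R) :
  tau' <= tau -> is_solution b omega T tau x -> is_solution b omega T tau' x.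
Proof.
move=> le_tau [acx x0 odex]; split=> //.
  exact: absolutely_continuous_sub acx.
apply: (lebesgue_ae1 _ odex) => t H /andP[t0 ttau']; apply: H.
by rewrite t0 (le_trans ttau').
Qed.

(** On the compact [0, T] the continuous negative function omega' is bounded
    away from 0, and b is negligible in front of it near 0. *)
Lemma drift_le_near0 (R : realType) (T : R) (omega b : R -> R) :
  0 < T -> C1_within `[0, T] omega ->
  (forall t, 0 <= t <= T -> derive_within `[0, T] omega t < 0) ->
  b x @[x --> 0^'] --> b 0 -> b 0 = 0 ->
  exists r c, [/\ 0 < r, 0 < c & forall z t, `|z| < r -> 0 <= t <= T ->
    b z + derive_within `[0, T] omega t <= - c].
Proof.
move=> T0 [_ cont] neg blim b0.
have [m mT mmax] := EVT_max (ltW T0) cont.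
have m0 : 0 < - derive_within `[0, T] omega m / 2.
  by rewrite divr_gt0 // oppr_gt0; apply: neg; rewrite in_itv in mT.
move: blim; rewrite b0 => /cvgrPdist_lt /(_ _ m0).
rewrite near_withinE => /nbhs_ballP[r /= r0 H].
exists r, (- derive_within `[0, T] omega m / 2); split=> // z t zr tT.
have bz : b z < - derive_within `[0, T] omega m / 2.
  have [->|z0] := eqVneq z 0; first by rewrite b0.
  have := H z; rewrite /ball /= !sub0r !normrN => /(_ zr z0).
  exact: le_lt_trans (ler_norm _).
have : derive_within `[0, T] omega t <= derive_within `[0, T] omega m.
  by apply: mmax; rewrite in_itv.
lra.
Qed.

Lemma solution_decrease (R : realType) (b omega : R -> R) (T tau c u v : R)
    (x : R -> R) :
  is_solution b omega T tau x -> 0 <= u -> u <= v -> v <= tau ->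
  (forall t, u <= t <= v ->
     b (x t) + derive_within `[0, T] omega t <= - c) ->
  x v + c * v <= x u + c * u.
Proof.
move=> [acx _ odex] u0 uv vtau drift.
have acx' : absolutely_continuous u v x by exact: absolutely_continuous_sub acx.
apply: (@absolutely_continuous_le R u v (fun t => x t + c * t)) => //.
  apply: (absolutely_continuous_dominated (L := 1 + `|c|)
            acx' (absolutely_continuous_id u v)) => p q _ _ _.
  rewrite (_ : _ - _ = (x q - x p) + c * (q - p)); last by ring.
  apply: le_trans (ler_normD _ _) _; rewrite normrM.
  have : 0 <= `|c| * `|x q - x p| by rewrite mulr_ge0.
  by have := normr_ge0 (q - p); lra.
apply: (lebesgue_ae1 _ odex) => t H /andP[ut tv].
have tI : 0 <= t <= tau by rewrite (le_trans u0 ut) (le_trans tv vtau).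
exists (b (x t) + derive_within `[0, T] omega t + c).
  have D : is_derive t 1 (c *: (@id R)) (c *: 1) by exact: is_deriveZ.
  apply: is_derive_eq (is_deriveD (H tI) D) _.
  by rewrite /GRing.scale /= mulr1.
have := drift t; rewrite ut tv => /(_ isT); lra.
Qed.

(** Near the level 0 the drift is negative, so a solution strictly decreases
    on every short interval with an end point on this level.  It therefore
    cannot become positive after its last zero, and it cannot return to 0 from
    below. *)
Lemma solution_negative (R : realType) (T tau : R) (omega b x : R -> R) :
  0 < T -> C1_within `[0, T] omega ->
  (forall t, 0 <= t <= T -> derive_within `[0, T] omega t < 0) ->
  b x @[x --> 0^'] --> b 0 -> b 0 = 0 ->
  tau <= T -> is_solution b omega T tau x ->
  forall t, 0 < t <= tau -> x t < 0.
Proof.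
move=> T0 C1 neg blim b0 tauT solx.
have [r [c [r0 c0 drift]]] := drift_le_near0 T0 C1 neg blim b0.
have [acx x0 _] := solx.
have [d d0 modx] := absolutely_continuous_modulus acx r0.
have decr u v : 0 <= u -> u < v -> v <= tau -> v - u < d ->
    x u = 0 \/ x v = 0 -> x v < x u.
  move=> u0 uv vtau vud xuv.
  have : x v + c * v <= x u + c * u.
    apply: (solution_decrease solx) => //; first exact: ltW.
    move=> t /andP[ut tv]; apply: drift; last by apply/andP; split; lra.
    case: xuv => xz; rewrite -[x t]subr0 -xz; apply: modx;
      rewrite ?ltr_distl; apply/andP; split; lra.
  have : 0 < c * (v - u) by rewrite mulr_gt0 ?subr_gt0.
  lra.
have nonpos t : 0 <= t <= tau -> x t <= 0.
  move=> /andP[t0 ttau]; rewrite leNgt; apply/negP => xt.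
  have acxt : absolutely_continuous 0 t x by exact: absolutely_continuous_sub acx.
  have [|s [s0 st xs pos]] := last_nonpositive acxt t0 _ xt; first by rewrite x0.
  have [v [sv vt vs]] := exists_right_near st d0.
  have := pos v; rewrite sv vt => /(_ isT).
  have := decr s v s0 sv (le_trans vt ttau); rewrite xs.
  have vsd : v - s < d by rewrite ltrBlDl.
  by move=> /(_ vsd (or_introl erefl)) xv /(lt_trans xv); rewrite ltxx.
move=> t /andP[t0 ttau].
rewrite lt_neqAle nonpos ?(ltW t0) // andbT; apply/eqP => xt.
pose u := Num.max 0 (t - d / 2).
have u0 : 0 <= u by rewrite /u le_max lexx.
have tu : t - d / 2 <= u by rewrite /u le_max lexx orbT.
have ut : u < t by rewrite /u gt_max; apply/andP; split; lra.
have tud : t - u < d by lra.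
have := decr u t u0 ut ttau tud (or_intror xt); rewrite xt ltNge nonpos //.
by apply/andP; split; lra.
Qed.

(** * Comparison of two ordered solutions *)

(** The slope of g may blow up at 0; it is bounded on [c, eta), being
    non-increasing. *)
Lemma concave_lipschitz (R : realType) (eta : \bar R) (g : R -> R)
  (g_incr : forall x y : R, 0 <= x -> x < y -> (y%:E < eta)%E -> g x < g y)
  (g_derivable : forall x : R, 0 < x -> (x%:E < eta)%E -> derivable g x 1)
  (g'_noninc : forall x y : R, 0 < x -> x <= y -> (y%:E < eta)%E ->
     derive1 g y <= derive1 g x) (c u v : R) :
  0 < c -> c <= u -> c <= v -> (u%:E < eta)%E -> (v%:E < eta)%E ->
  `|g v - g u| <= derive1 g c * `|v - u|.
Proof.
move=> c0.
wlog uv : u v / u < v.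
  move=> W cu cv ue ve; have [uv|vu|->] := ltgtP u v.
  - exact: W.
  - by rewrite distrC (distrC v); exact: W.
  - by rewrite !subrr normr0 mulr0.
move=> cu cv ue ve.
have lt_eta t : t <= v -> (t%:E < eta)%E.
  by move=> tv; apply: le_lt_trans ve; rewrite lee_fin.
have der t : u <= t <= v -> derivable g t 1.
  by move=> /andP[ut tv]; apply: g_derivable; [lra | exact: lt_eta].
have [||t] := @MVT _ g (derive1 g) u v uv.
- move=> t; rewrite in_itv /= => /andP[ut tv]; rewrite derive1E.
  by apply/derivableP/der; rewrite !ltW.
- by apply: derivable_within_continuous => t; rewrite in_itv; exact: der.
rewrite in_itv /= => /andP[/ltW ut /ltW tv] E.
have guv : g u < g v by apply: g_incr => //; lra.
rewrite !gtr0_norm ?subr_gt0 // E ler_wpM2r ?subr_ge0 ?(ltW uv) //.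
by apply: g'_noninc; [|lra|exact: lt_eta].
Qed.

Lemma ereal_ltN_locally (R : realType) (eta : \bar R) (z : R) :
  (- eta < z%:E)%E ->
  exists2 e, 0 < e & forall z', `|z' - z| < e -> (- eta < z'%:E)%E.
Proof.
case: eta => [h| |] //= hz; last by exists 1 => // z' _; rewrite ltNyr.
rewrite lte_fin in hz; exists (z + h); first lra.
by move=> z'; rewrite ltr_distl lte_fin => /andP[+ _]; lra.
Qed.

Lemma ereal_lteN (R : realType) (eta : \bar R) (z : R) :
  (- eta < z%:E)%E -> ((- z)%:E < eta)%E.
Proof. by rewrite lteNl EFinN. Qed.

(** The heart of the proof.  For y < x < 0 write w for omega'; almost everywhere
    the gap g(-y) - g(-x) has derivative
    [g'(-x) b(x) - g'(-y) b(y)] + w [g'(-x) - g'(-y)].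
    The first bracket is nonpositive since z |-> g'(-z) b(z) is non-increasing,
    the second one is nonnegative since g' is non-increasing, and w < 0.
    The gap is absolutely continuous because x stays away from 0 on [u, v],
    where g is Lipschitz on the range of -x and -y. *)
Lemma solution_gap_noninc (R : realType) (T tau u v : R)
  (omega b x y : R -> R)
  (omega_neg : forall t : R, 0 <= t <= T -> derive_within `[0, T] omega t < 0)
  (eta : \bar R) (g : R -> R)
  (g_incr : forall x y : R, 0 <= x -> x < y -> (y%:E < eta)%E -> g x < g y)
  (g_derivable : forall x : R, 0 < x -> (x%:E < eta)%E -> derivable g x 1)
  (g'_noninc : forall x y : R, 0 < x -> x <= y -> (y%:E < eta)%E ->
     derive1 g y <= derive1 g x)
  (g'b_noninc : forall x y : R, (- eta < x%:E)%E -> x <= y -> y < 0 ->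
     derive1 g (- y) * b y <= derive1 g (- x) * b x) :
  tau <= T -> is_solution b omega T tau x -> is_solution b omega T tau y ->
  0 <= u -> u <= v -> v <= tau ->
  (forall t, u <= t <= v -> [/\ (- eta < (y t)%:E)%E, y t < x t & x t < 0]) ->
  g (- y v) - g (- x v) <= g (- y u) - g (- x u).
Proof.
move=> tauT [acx _ odex] [acy _ odey] u0 uv vtau order.
have acx' : absolutely_continuous u v x by exact: absolutely_continuous_sub acx.
have acy' : absolutely_continuous u v y by exact: absolutely_continuous_sub acy.
have xeta t : u <= t <= v -> (- eta < (x t)%:E)%E.
  by move=> /order[yeta yx _]; apply: lt_trans yeta _; rewrite lte_fin.
have [m mI xm] := EVT_max uv (absolutely_continuous_within acx').
have xm0 : 0 < - x m by rewrite in_itv in mI; have [_ _] := order _ mI; rewrite oppr_gt0.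
apply: (@absolutely_continuous_le R u v (fun t => g (- y t) - g (- x t))) => //.
  apply: (absolutely_continuous_dominated (L := derive1 g (- x m)) acx' acy').
  move=> p q up pq qv.
  have away t : u <= t <= v -> - x m <= - x t /\ - x m <= - y t.
    move=> tI; have [_ /ltW yx _] := order _ tI.
    have : x t <= x m by apply: xm; rewrite in_itv.
    by rewrite !lerN2 => xt; split=> //; exact: le_trans xt.
  have pI : u <= p <= v by rewrite up (le_trans pq).
  have qI : u <= q <= v by rewrite qv (le_trans up).
  have [xmp ymp] := away _ pI; have [xmq ymq] := away _ qI.
  have [yp _ _] := order _ pI; have [yq _ _] := order _ qI.
  have lip := concave_lipschitz g_incr g_derivable g'_noninc xm0.
  have Lx := lip _ _ xmp xmq (ereal_lteN (xeta _ pI)) (ereal_lteN (xeta _ qI)).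
  have Ly := lip _ _ ymp ymq (ereal_lteN yp) (ereal_lteN yq).
  rewrite -opprD normrN in Lx; rewrite -opprD normrN in Ly.
  rewrite (_ : _ - _ = (g (- y q) - g (- y p)) - (g (- x q) - g (- x p)));
    last by ring.
  by apply: le_trans (ler_normB _ _) _; rewrite mulrDr addrC lerD.
apply: (lebesgue_ae2 _ odex odey) => t Hx Hy tI.
have [etay yx x0] := order _ tI; have etax := xeta _ tI.
have {tI}[tI0 tIT] : 0 <= t <= tau /\ 0 <= t <= T.
  move: tI => /andP[ut tv]; rewrite (le_trans u0 ut) (le_trans tv vtau).
  by rewrite (le_trans tv (le_trans vtau tauT)).
have gder z : z < 0 -> (- eta < z%:E)%E ->
    is_derive (- z) 1 g (derive1 g (- z)).
  move=> z0 zeta; rewrite derive1E; apply/derivableP/g_derivable.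
    by rewrite oppr_gt0.
  exact: ereal_lteN.
have y0 : y t < 0 := lt_trans yx x0.
have Dx := @is_derive1_comp R g (- x) t _ _ (gder _ x0 etax) (is_deriveN (Hx tI0)).
have Dy := @is_derive1_comp R g (- y) t _ _ (gder _ y0 etay) (is_deriveN (Hy tI0)).
exists (derive1 g (- y t) * - (b (y t) + derive_within `[0, T] omega t) -
        derive1 g (- x t) * - (b (x t) + derive_within `[0, T] omega t)).
  exact: is_deriveB Dy Dx.
have gb := g'b_noninc _ _ etay (ltW yx) x0.
have gg : derive1 g (- y t) <= derive1 g (- x t).
  by apply: g'_noninc; rewrite ?oppr_gt0 ?lerN2 ?(ltW yx) //; exact: ereal_lteN.
have : 0 <= (derive1 g (- x t) - derive1 g (- y t)) *
    - derive_within `[0, T] omega t.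
  by rewrite mulr_ge0 ?subr_ge0 ?oppr_ge0 ?(ltW (omega_neg t tIT)).
by clear -gb; lra.
Qed.

(** After a common value at time s the gap g(-y) - g(-x) would be positive and
    non-increasing, yet it tends to 0 at s by continuity of g.  The limit is
    taken through times s' > s because at s = 0 both solutions vanish and g
    need not be Lipschitz there. *)
Lemma solutions_not_separate (R : realType) (T tau s t1 : R)
  (omega b x y : R -> R)
  (omega_neg : forall t : R, 0 <= t <= T -> derive_within `[0, T] omega t < 0)
  (eta : \bar R) (g : R -> R)
  (g_incr : forall x y : R, 0 <= x -> x < y -> (y%:E < eta)%E -> g x < g y)
  (g_cont : {within [set x : R | 0 <= x /\ (x%:E < eta)%E], continuous g})
  (g_derivable : forall x : R, 0 < x -> (x%:E < eta)%E -> derivable g x 1)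
  (g'_noninc : forall x y : R, 0 < x -> x <= y -> (y%:E < eta)%E ->
     derive1 g y <= derive1 g x)
  (g'b_noninc : forall x y : R, (- eta < x%:E)%E -> x <= y -> y < 0 ->
     derive1 g (- y) * b y <= derive1 g (- x) * b x) :
  tau <= T -> is_solution b omega T tau x -> is_solution b omega T tau y ->
  (forall t, 0 < t <= tau -> x t < 0) ->
  0 <= s -> s < t1 -> t1 <= tau -> x s = y s -> (- eta < (x s)%:E)%E ->
  ~ (forall t, s < t <= t1 -> y t < x t).
Proof.
move=> tauT solx soly xneg s0 st1 t1tau xys etas yx.
have [acx x0 _] := solx; have [acy y0 _] := soly.
have x_le0 : x s <= 0.
  by move: s0; rewrite le_eqVlt => /orP[/eqP<-|s0];
    rewrite ?x0 // ltW // xneg // s0 ltW // (lt_le_trans st1).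
(* Only the common value is known to exceed -eta: stop at a time t2 before
   which y has not reached -eta. *)
have [e e0 He] := ereal_ltN_locally etas.
have [d d0 mody] := absolutely_continuous_modulus acy e0.
have [t2 [st2 t21 t2s]] := exists_right_near st1 d0.
have yeta t : s <= t <= t2 -> (- eta < (y t)%:E)%E.
  move=> /andP[st tt2]; apply: He; rewrite xys; apply: mody;
    rewrite ?ltr_distl; apply/andP; split; lra.
have yx2 t : s < t <= t2 -> y t < x t.
  by move=> /andP[st tt2]; apply: yx; rewrite st (le_trans tt2).
have xneg2 t : s < t <= t2 -> x t < 0.
  by move=> /andP[st tt2]; apply: xneg; apply/andP; split; lra.
have xeta t : s < t <= t2 -> (- eta < (x t)%:E)%E.
  move=> /andP[st tt2]; apply: (@lt_trans _ _ (y t)%:E).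
    by apply: yeta; rewrite ltW.
  by rewrite lte_fin yx2 // st.
pose phi t := g (- y t) - g (- x t).
have t2I : s < t2 <= t2 by rewrite st2 lexx.
have phi2 : 0 < phi t2.
  have := xneg2 _ t2I; have := yx2 _ t2I => yxt xt.
  rewrite subr_gt0; apply: g_incr; [lra|lra|].
  by apply/ereal_lteN/yeta; rewrite lexx ltW.
have phi2' : 0 < phi t2 / 2 by rewrite divr_gt0.
(* A time s' at which both solutions are so close to their common value that
   the gap is smaller than at t2. *)
have [r r0 Hr] : exists2 r, 0 < r & forall z, `|z + x s| < r -> 0 <= z ->
    (z%:E < eta)%E -> `|g (- x s) - g z| < phi t2 / 2.
  have pA : [set z : R | 0 <= z /\ (z%:E < eta)%E] (- x s).
    by split; [rewrite oppr_ge0 | exact: ereal_lteN].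
  have /cvgrPdist_lt /(_ _ phi2') := (subspace_continuousP _ _).1 g_cont _ pA.
  rewrite near_withinE => /nbhs_ballP[r /= r0 H]; exists r => // z zr z0 zeta.
  by apply: H => //; rewrite /ball /= distrC opprK.
have [dx dx0 modx'] := absolutely_continuous_modulus acx r0.
have [dy dy0 mody'] := absolutely_continuous_modulus acy r0.
have dxy0 : 0 < Num.min dx dy by rewrite lt_min dx0.
have [s' [ss' s'2 s's]] := exists_right_near st2 dxy0.
have dxx : Num.min dx dy <= dx by rewrite ge_min lexx.
have dyy : Num.min dx dy <= dy by rewrite ge_min lexx orbT.
have s'I : s < s' <= t2 by rewrite ss'.
have stau : 0 <= s <= tau by rewrite s0 (le_trans (ltW st1)).
have s'tau : 0 <= s' <= tau.
  by rewrite (le_trans s0 (ltW ss')) (le_trans s'2) // (le_trans t21).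
have s'd : `|s' - s| < Num.min dx dy.
  by rewrite gtr0_norm ?subr_gt0 // ltrBlDl.
have phis' : phi s' < phi t2.
  have := xneg2 _ s'I; have := yx2 _ s'I => yxs xs.
  have : `|g (- x s) - g (- x s')| < phi t2 / 2.
    apply: Hr; [|lra|exact/ereal_lteN/xeta].
    rewrite (_ : _ + _ = - (x s' - x s)) ?normrN; last by ring.
    by apply: modx' => //; exact: lt_le_trans dxx.
  have : `|g (- x s) - g (- y s')| < phi t2 / 2.
    apply: Hr; [|by rewrite oppr_ge0 ltW // (lt_trans yxs)|by apply/ereal_lteN/yeta; rewrite ltW].
    rewrite xys (_ : _ + _ = - (y s' - y s)) ?normrN; last by ring.
    by apply: mody' => //; exact: lt_le_trans dyy.
  rewrite !ltr_distl [phi s']/phi => /andP[+ _] /andP[_ +].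
  by clear; lra.
have : phi t2 <= phi s'.
  apply: (solution_gap_noninc omega_neg g_incr g_derivable g'_noninc g'b_noninc
            tauT solx soly) => //.
  - exact: le_trans s0 (ltW ss').
  - exact: le_trans t21 t1tau.
  - move=> t /andP[st tt2]; have ss't := lt_le_trans ss' st.
    split; [apply: yeta|apply: yx2|apply: xneg2]; rewrite tt2 ?ss't //.
    by rewrite ltW.
by rewrite leNgt phis'.
Qed.

(** The lower bound -eta is required of x alone: at the last meeting time
    before a separation, y shares the value of x. *)
Lemma solution_unique (R : realType) (T tau : R)
  (omega b x y : R -> R)
  (T0 : 0 < T)
  (omega_C1 : C1_within `[0, T] omega)
  (omega_neg : forall t : R, 0 <= t <= T -> derive_within `[0, T] omega t < 0)
  (b_lim : b x @[x --> (0 : R)^'] --> b 0)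
  (b0 : b 0 = 0)
  (eta : \bar R) (g : R -> R)
  (g_incr : forall x y : R, 0 <= x -> x < y -> (y%:E < eta)%E -> g x < g y)
  (g_cont : {within [set x : R | 0 <= x /\ (x%:E < eta)%E], continuous g})
  (g_derivable : forall x : R, 0 < x -> (x%:E < eta)%E -> derivable g x 1)
  (g'_noninc : forall x y : R, 0 < x -> x <= y -> (y%:E < eta)%E ->
     derive1 g y <= derive1 g x)
  (g'b_noninc : forall x y : R, (- eta < x%:E)%E -> x <= y -> y < 0 ->
     derive1 g (- y) * b y <= derive1 g (- x) * b x) :
  tau <= T -> is_solution b omega T tau x -> is_solution b omega T tau y ->
  (forall t, 0 <= t <= tau -> (- eta < (x t)%:E)%E) ->
  forall t, 0 <= t <= tau -> y t = x t.
Proof.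
move=> tauT solx soly xeta t /andP[t0 ttau].
have xneg := solution_negative T0 omega_C1 omega_neg b_lim b0 tauT solx.
have yneg := solution_negative T0 omega_C1 omega_neg b_lim b0 tauT soly.
have [acx x0 _] := solx; have [acy y0 _] := soly.
have acD (u v : R -> R) : absolutely_continuous 0 tau u ->
    absolutely_continuous 0 tau v ->
    absolutely_continuous 0 t (fun s => u s - v s).
  move=> acu acv; apply: (@absolutely_continuous_sub R 0 tau) => //.
  apply: (absolutely_continuous_dominated (L := 1) acu acv) => p q _ _ _.
  rewrite mul1r (_ : _ - _ = (u q - u p) - (v q - v p)); last by ring.
  exact: ler_normB.
have sep := @solutions_not_separate R T tau _ _ omega b.
have [yx|xy|//] := ltgtP (y t) (x t).
- have [||s [s0 st xs pos]] := last_nonpositive (acD _ _ acx acy) t0.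
  + by rewrite x0 y0 subrr.
  + by rewrite subr_gt0.
  have xys : x s = y s by apply/eqP; rewrite -subr_eq0 xs.
  exfalso; apply: (sep s t x y omega_neg eta g) => //.
  + by apply: xeta; rewrite s0 ltW // (lt_le_trans st).
  + by move=> r /pos; rewrite subr_gt0.
- have [||s [s0 st xs pos]] := last_nonpositive (acD _ _ acy acx) t0.
  + by rewrite x0 y0 subrr.
  + by rewrite subr_gt0.
  have xys : y s = x s by apply/eqP; rewrite -subr_eq0 xs.
  exfalso; apply: (sep s t y x omega_neg eta g) => //.
  + by rewrite xys; apply: xeta; rewrite s0 ltW // (lt_le_trans st).
  + by move=> r /pos; rewrite subr_gt0.
Qed.

(** * Local and global uniqueness *)

Theorem theorem4p1 (R : realType) (T : R) (omega b : R -> R)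
  (hT : 0 < T)
  (omega_C1 : C1_within `[0, T] omega)
  (omega0 : omega 0 = 0)
  (omega_neg : forall t : R, 0 <= t <= T -> derive_within `[0, T] omega t < 0)
  (b_meas : measurable_fun setT b)
  (b_lim : b x @[x --> (0 : R)^'] --> b 0)
  (b0 : b 0 = 0)
  (eta : \bar R) (heta : (0 < eta)%E)
  (g : R -> R)
  (g_incr : forall x y : R, 0 <= x -> x < y -> (y%:E < eta)%E -> g x < g y)
  (g_cont : {within [set x : R | 0 <= x /\ (x%:E < eta)%E], continuous g})
  (g_derivable : forall x : R, 0 < x -> (x%:E < eta)%E -> derivable g x 1)
  (g'_cont : forall x : R, 0 < x -> (x%:E < eta)%E ->
     {for x, continuous (derive1 g)})
  (g'_noninc : forall x y : R, 0 < x -> x <= y -> (y%:E < eta)%E ->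
     derive1 g y <= derive1 g x)
  (g'b_noninc : forall x y : R, (- eta < x%:E)%E -> x <= y -> y < 0 ->
     derive1 g (- y) * b y <= derive1 g (- x) * b x)
  (max_or_min :
     (exists (tau : R) (x : R -> R), 0 < tau <= T /\ is_maximal_solution b omega T tau x) \/
     (exists (tau : R) (x : R -> R), 0 < tau <= T /\ is_minimal_solution b omega T tau x)) :
  (exists tau : R, 0 < tau <= T /\
     exists x : R -> R, is_solution b omega T tau x /\
       forall y : R -> R, is_solution b omega T tau y ->
         forall t : R, 0 <= t <= tau -> y t = x t) /\
  (eta = +oo%E ->
     forall x y : R -> R, is_solution b omega T T x ->
       is_solution b omega T T y -> forall t : R, 0 <= t <= T -> x t = y t).
Proof.
have unique tau x y := @solution_unique R T tau omega b x y hT omega_C1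
  omega_neg b_lim b0 eta g g_incr g_cont g_derivable g'_noninc g'b_noninc.
split; last first.
  move=> etaoo x y solx soly t tT.
  apply: esym; apply: (unique T x y) => // s _; rewrite etaoo /= ltNyr //.
have [tau [x [/andP[tau0 tauT] solx]]] : exists tau x, 0 < tau <= T /\
    is_solution b omega T tau x.
  by case: max_or_min => -[tau [x [tauI [solx _]]]]; exists tau, x.
have [acx x0 _] := solx.
have eta0 : (- eta < 0%:E)%E by rewrite lteNl oppe0.
have [e e0 He] := ereal_ltN_locally eta0.
have [d d0 modx] := absolutely_continuous_modulus acx e0.
have [tau' [tau'0 tau'tau tau'd]] := exists_right_near tau0 d0.
have tau'T : tau' <= T := le_trans tau'tau tauT.
have solx' := solution_restrict tau'tau solx.
exists tau'; split; first by rewrite tau'0.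
exists x; split=> // y soly; apply: unique => // t /andP[t0 tt].
apply: He; rewrite -x0; apply: modx; rewrite ?ltr_distl; apply/andP; split; lra.
Qed.
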